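(* Let $n\ge3$ be a fixed integer. For $\beta\in(0,1)$ let $r(n,\beta)$ be a radius (radial coordinate) corresponding to a critical point (equilibrium position) of $U_\beta$ different from the origin. Then $$\lim_{\beta\to0+}r(n,\beta)=0.$$
   Context: Positive unit point charges are placed at the vertices $\zeta_n^j=e^{2\pi i j/n}$, $j=1,\dots,n$, of a regular $n$-gon inscribed in the unit circle. For $z=re^{i\theta}$ with $r\in[0,1)$, $\theta\in[0,2\pi)$, the Riesz potential is $$U_\beta(r,\theta)=\sum_{j=1}^n|z-\zeta_n^j|^{-2\beta}=\sum_{j=1}^n\frac{1}{(1+r^2-2r\cos(2\pi j/n-\theta))^{\beta}}.$$ It is regarded as a smooth function on the open unit disc in $\mathbb{R}^2\cong\mathbb{C}$; a critical point (equilibrium position) is a point of the open unit disc where its gradient vanishes. If there are several critical points different from the origin, $r(n,\beta)$ denotes an arbitrary choice among their radial coordinates. *)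

(* Defs.v *)
From HB Require Import structures.
From mathcomp Require Import all_boot all_order all_algebra.
From mathcomp Require Import ring.
From mathcomp Require Import all_classical all_reals all_analysis.

Set Implicit Arguments.
Unset Strict Implicit.
Unset Printing Implicit Defensive.

Import Order.TTheory GRing.Theory Num.Theory.
Import numFieldNormedType.Exports.

Local Open Scope classical_set_scope.
Local Open Scope ring_scope.

Section RieszPotential.
Variable R : realType.
Implicit Types (z : 'rV[R]_2) (r t b : R) (n j : nat).

(* The library norm `|z| on 'rV[R]_2 is the sup norm; this is the modulus of
   z under the identification of R^2 with C. *)
Definition modulus z : R := Num.sqrt (z 0 0 ^+ 2 + z 0 1 ^+ 2).

Definition polar r t : 'rV[R]_2 :=
  \row_(k < 2) (if k == 0 then r * cos t else r * sin t).

(* zeta_n ^ j = exp (2 pi i j / n) *)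
Definition vertex n j : 'rV[R]_2 := polar 1 (2 * pi * j%:R / n%:R).

(* At a vertex itself, which lies outside the open unit disc, the infinite
   term is replaced by 0 `^ (- 2 b) = 0. *)
Definition riesz_potential n b z : R :=
  \sum_(1 <= j < n.+1) modulus (z - vertex n j) `^ (- 2 * b).

Definition gradient (f : 'rV[R]_2 -> R) z : 'rV[R]_2 :=
  \row_(k < 2) 'D_(delta_mx 0 k) f z.

Definition equilibrium n b z : Prop :=
  modulus z < 1 /\ gradient (riesz_potential n b) z = 0.

Lemma riesz_potential_polar n b r t :
  riesz_potential n b (polar r t) =
  \sum_(1 <= j < n.+1)
    1 / (1 + r ^+ 2 - 2 * r * cos (2 * pi * j%:R / n%:R - t)) `^ b.
Proof.
apply: eq_bigr => j _; rewrite /modulus !mxE /= !mul1r.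
set a := 2 * pi * _ / _.
have -> : (r * cos t - cos a) ^+ 2 + (r * sin t - sin a) ^+ 2 =
          1 + r ^+ 2 - 2 * r * cos (a - t).
  transitivity (r ^+ 2 * (cos t ^+ 2 + sin t ^+ 2) +
    (cos a ^+ 2 + sin a ^+ 2) - 2 * r * (cos a * cos t + sin a * sin t)).
    by ring.
  by rewrite !cos2Dsin2 cosB; ring.
have h : 0 <= 1 + r ^+ 2 - 2 * r * cos (a - t).
  have -> : 1 + r ^+ 2 - 2 * r * cos (a - t) =
            (r - cos (a - t)) ^+ 2 + sin (a - t) ^+ 2.
    by rewrite sin2cos2; ring.
  by rewrite addr_ge0 ?sqr_ge0.
by rewrite -powR12_sqrt // -powRrM -powRN; congr (_ `^ _); field.
Qed.

End RieszPotential.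

(* Main.v *)
Require Import Defs.
From mathcomp Require Import all_boot all_order all_algebra.
From mathcomp Require Import ring lra complex.
From mathcomp Require Import all_classical all_reals all_analysis.
Import Order.TTheory GRing.Theory Num.Theory.
Import numFieldNormedType.Exports.
Local Open Scope classical_set_scope.
Local Open Scope ring_scope.

(* Write d_j for the distance from z to the vertex zeta^j, D for the smallest
   d_j, and w_j = (D / d_j)^(2 b), so that 0 < w_j <= 1.  After conjugation and
   rescaling by D^(2 b), the vanishing of the gradient of U_b reads
   sum_j w_j / (z - zeta^j) = 0.  With all weights replaced by 1, the left-hand
   side is the logarithmic derivative of z^n - 1, hence
     n z^(n-1) = prod_k (z - zeta^k) * sum_j (1 - w_j) / (z - zeta^j).
   Now 1 - w_j <= 2 b ln (d_j / D) <= 2 b d_j / D.  The factor d_j cancels the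
   pole at zeta^j, and the factor 1 / D cancels the smallest factor of the
   product, whose other factors are at most 2.  Therefore
   |z|^(n-1) <= b 2^n on the whole open disc. *)

(** * Real-variable estimates *)

Lemma one_sub_powR_le (R : realType) (D d b : R) : 0 < D -> D <= d -> 0 <= b ->
  0 <= 1 - (D / d) `^ b <= b * (d / D).
Proof.
move=> D0 Dd b0; have d0 := lt_le_trans D0 Dd.
have Ddi : 0 < D / d by rewrite divr_gt0.
apply/andP; split.
  rewrite subr_ge0 -[leRHS](congr1 (@^~ b) (powR1 R)) ge0_ler_powR ?nnegrE ?(ltW Ddi)//.
  by rewrite ler_pdivrMr// mul1r.
(* The power is exp (- b ln (d / D)), which lies above its tangent 1 - b ln (d / D); then ln x <
   x. *)
rewrite /powR gt_eqF// -[D / d]invf_div lnV ?posrE ?divr_gt0//.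
have := expR_ge1Dx (b * - ln (d / D)).
have := @ln_sublinear _ (d / D) (divr_gt0 d0 D0).
move=> /ltW /(ler_wpM2l b0); lra.
Qed.

Lemma cvg0_exp_le (R : realType) (r : R -> R) (m : nat) (K : R) :
  (forall b, 0 < b < 1 -> 0 <= r b /\ r b ^+ m.+1 <= b * K) ->
  r b @[b --> 0^'+] --> (0 : R).
Proof.
move=> rb; apply/cvgrPdist_lt => e e0.
(* [|K| + 1] dominates K and is positive whatever the sign of K, so it can serve as a
   denominator. *)
have K0 : 0 < `|K| + 1 by rewrite ltr_wpDl.
near=> b.
have b0 : 0 < b by near: b; exact: nbhs_right_gt.
have b1 : b < 1 by near: b; exact: nbhs_right_lt.
have be : b < e ^+ m.+1 / (`|K| + 1).
  by near: b; apply: nbhs_right_lt; rewrite divr_gt0 ?exprn_gt0.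
have [|r0 rK] := rb b; first by rewrite b0.
rewrite sub0r normrN ger0_norm// -(@ltr_pXn2r _ m.+1) ?nnegrE ?(ltW e0)//.
move: be; rewrite ltr_pdivlMr// => be; apply: le_lt_trans be.
by rewrite (le_trans rK)// ler_pM2l// (le_trans (ler_norm K))// lerDl.
Unshelve. all: by end_near. Qed.

(** * Partial derivatives of the potential *)

Lemma is_derive_line (R : realType) (V W : normedModType R) (f : V -> W)
    (a v : V) (df : W) :
  is_derive (0 : R) (1 : R) (fun h => f (h *: v + a)) df -> is_derive a v f df.
Proof.
(* Both derivatives are limits of the same difference quotient; partial derivatives thus reduce to
   one-variable calculus. *)
have E : (fun h : R => h^-1 *:
      (((fun h => f (h *: v + a)) \o shift 0) (h *: 1) - f (0 *: v + a))) =
    (fun h => h^-1 *: ((f \o shift a) (h *: v) - f a)).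
  by apply/funext => h /=; rewrite addr0 scale0r add0r -[h *: 1]/(h * 1) mulr1.
by case=> d1 d2; constructor; [move: d1|move: d2]; rewrite /derivable /derive E.
Qed.

Lemma modulus_ge0 (R : realType) (z : 'rV[R]_2) : 0 <= modulus z.
Proof. exact: sqrtr_ge0. Qed.

Lemma modulus_gt0 (R : realType) (z : 'rV[R]_2) : z != 0 -> 0 < modulus z.
Proof.
move=> z0; rewrite sqrtr_gt0 lt_neqAle addr_ge0 ?sqr_ge0// andbT eq_sym.
apply: contra z0; rewrite paddr_eq0 ?sqr_ge0// !sqrf_eq0 => /andP[/eqP z0 /eqP z1].
by apply/eqP/rowP => i; rewrite [RHS]mxE; case: i => -[|[|//]] p;
  [rewrite -[RHS]z0 | rewrite -[RHS]z1]; congr (_ _ _); apply: val_inj.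
Qed.

Lemma is_derive_modulus_powR (R : realType) (v z : 'rV[R]_2) (b : R) (k : 'I_2) :
  z != v ->
  is_derive z (delta_mx 0 k) (fun z => modulus (z - v) `^ (- 2 * b))
   (- 2 * b * (modulus (z - v) `^ (- 2 * b) * ((z - v) 0 k / modulus (z - v) ^+ 2))).
Proof.
move=> zv; apply: is_derive_line.
set u := z - v.
(* The squared modulus along the k-th axis is polynomial in h, so the square root never has to be
   differentiated; the Kronecker deltas treat both axes at once. *)
pose q h : R := (u 0 0 + h * (k == 0)%:R) ^+ 2 + (u 0 1 + h * (k == 1)%:R) ^+ 2.
have q0 h : 0 <= q h by rewrite addr_ge0 ?sqr_ge0.
have qE h : modulus (h *: delta_mx 0 k + z - v) `^ (- 2 * b) = q h `^ (- b).
  rewrite /modulus -powR12_sqrt ?addr_ge0 ?sqr_ge0// -powRrM.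
  rewrite !mxE /=; congr (_ `^ _); last by field.
  by rewrite /q !mxE !(eq_sym k); congr (_ ^+ 2 + _ ^+ 2); ring.
have m2 : modulus u ^+ 2 = q 0.
  by rewrite /modulus sqr_sqrtr ?addr_ge0 ?sqr_ge0// /q !mul0r !addr0.
have qq : 0 < q 0 by rewrite -m2 exprn_gt0// modulus_gt0// subr_eq0.
under eq_fun do rewrite qE.
have := qE 0; rewrite scale0r add0r -/u m2 => ->.
have dl (c a : R) : is_derive (0 : R) (1 : R) (fun h : R => (c + h * a) ^+ 2) (2 * c * a).
  apply: is_derive_eq; rewrite !scaler0 mul0r !addr0 /= scaler1 add0r.
  by rewrite -[c *: _]/(c * _); ring.
have dq : is_derive (0 : R) (1 : R) q (2 * u 0 k).
  apply: (is_derive_eq (is_deriveD (dl _ _) (dl _ _))).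
  case: k {qE q q0 qq m2 dl} => -[|[|//]] p; rewrite /= ?(mulr1, mulr0, addr0, add0r);
  by congr (_ * u _ _); apply: val_inj.
have dp := is_derive1_powR (- b) qq.
apply: (is_derive_eq (is_derive1_comp dp dq)).
rewrite powRB; last by rewrite (gt_eqF qq) implybT.
rewrite powRr1 ?(ltW qq)//.
have q1 : q 0 != 0 by rewrite gt_eqF.
by field.
Qed.

(** * Logarithmic derivatives of polynomials *)

Lemma horner_deriv_prod_XsubC (F : fieldType) (I : eqType) (s : seq I) (c : I -> F) (x : F) :
  (forall i, i \in s -> x != c i) ->
  (\prod_(i <- s) ('X - (c i)%:P))^`().[x] =
  (\prod_(i <- s) (x - c i)) * \sum_(i <- s) (x - c i)^-1.
Proof.
elim: s => [|i s IHs] xc; first by rewrite !big_nil derivC horner0 mulr0.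
rewrite !big_cons derivM derivXsubC mul1r hornerD hornerM hornerXsubC.
rewrite horner_prod IHs; last by move=> k ks; rewrite xc// inE ks orbT.
under eq_bigr do rewrite hornerXsubC.
have : x - c i != 0 by rewrite subr_eq0 xc// mem_head.
by move=> xi; field.
Qed.

(** The central estimate, for arbitrary roots [c] and weights [w]. It is applied with [i0] the index
    of the root nearest to [x]; cancelling the factor of [i0] leaves n - 1 factors, whence the
    exponent. *)
Lemma norm_horner_deriv_prod_XsubC_le (C : numFieldType) (n : nat)
    (c w : 'I_n -> C) (x e M : C) (i0 : 'I_n) :
  (forall i, x != c i) ->
  \sum_i w i / (x - c i) = 0 ->
  (forall i, `|1 - w i| <= e * (`|x - c i| / `|x - c i0|)) ->
  (forall i, `|x - c i| <= M) -> 0 <= e ->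
  `|(\prod_i ('X - (c i)%:P))^`().[x]| <= (e *+ n) * M ^+ n.-1.
Proof.
move=> xc w0 we xM e0.
have d0 i : 0 < `|x - c i| by rewrite normr_gt0 subr_eq0.
rewrite horner_deriv_prod_XsubC//.
have -> : \sum_i (x - c i)^-1 = \sum_i (1 - w i) / (x - c i).
  by under [RHS]eq_bigr do rewrite mulrBl mul1r; rewrite sumrB w0 subr0.
rewrite normrM normr_prod.
apply: (@le_trans _ _ ((\prod_i `|x - c i|) * (e / `|x - c i0| *+ n))).
  apply: ler_wpM2l; first exact: prodr_ge0.
  apply: (le_trans (ler_norm_sum _ _ _)).
  rewrite -[X in _ *+ X](card_ord n) -sumr_const; apply: ler_sum => i _.
  rewrite normrM normfV ler_pdivrMr// (le_trans (we i))//.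
  by rewrite mulrAC mulrA.
rewrite (bigD1 i0)//=; set P := \prod_(i | _) _.
have -> : `|x - c i0| * P * (e / `|x - c i0| *+ n) = (e *+ n) * P.
  by rewrite -mulrnAl; have := gt_eqF (d0 i0); move/negbT => ?; field.
apply: ler_wpM2l; first exact: mulrn_wge0.
rewrite /P (le_trans (ler_prod (E2 := fun=> M) _ _))//; last first.
  by rewrite prodr_const cardC1 card_ord.
by move=> i _; rewrite normr_ge0 xM.
Qed.

Lemma prod_XsubC_unity (F : fieldType) (n : nat) (z : F) :
  n.-primitive_root z -> \prod_(i < n) ('X - (z ^+ i.+1)%:P) = 'X^n - 1.
Proof.
move=> zn; rewrite -(factor_Xn_sub_1 zn).
case: n zn => [|n] zn; first by rewrite big_ord0 big_geq.
(* Exponents run over 1..n here and over 0..n-1 in the factorization; the two extreme factors agree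
   because z^n = 1 = z^0. *)
rewrite big_ord_recr /= (prim_expr_order zn) big_nat_recl// expr0 mulrC.
by rewrite big_mkord.
Qed.

(** * Passage to complex numbers *)

Section Complex.
Variable R : realType.
Local Open Scope complex_scope.

Definition expi (t : R) : R[i] := cos t +i* sin t.

Lemma expiX t n : expi t ^+ n = expi (t *+ n).
Proof.
elim: n => [|n IHn]; first by rewrite mulr0n /expi cos0 sin0.
rewrite exprS IHn mulrS /expi; apply/eqP; rewrite eq_complex /= cosD sinD.
by rewrite addrC [cos t * _ + _]addrC eqxx [_ + cos t * _]addrC eqxx.
Qed.

Lemma expi_prim_root n : (0 < n)%N -> n.-primitive_root (expi (2 * pi / n%:R)).
Proof.
move=> n0; have nR : n%:R != 0 :> R by rewrite pnatr_eq0 -lt0n.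
rewrite /primitive_root_of_unity n0; apply/forallP => i; apply/eqP.
rewrite unity_rootE expiX.
(* Half angles: for i + 1 < n the half angle t lies in (0, pi), so cos 2t = 1 - 2 sin^2 t < 1 and
   the power is not 1. *)
have -> : 2 * pi / n%:R *+ i.+1 = (pi * i.+1%:R / n%:R) *+ 2 :> R.
  by rewrite -[LHS]mulr_natr -[RHS]mulr_natr; field.
rewrite /expi.
have : (i.+1 <= n)%N by [].
rewrite leq_eqVlt => /orP[/eqP ->|ltn].
  by rewrite mulfK// cos2pi sin2pi !eqxx.
rewrite (ltn_eqF ltn); apply/negbTE; rewrite eq_complex /= negb_and.
set t := pi * _ / _.
have -> : cos (t *+ 2) = 1 - sin t ^+ 2 *+ 2 by rewrite cos_mulr2n cos2sin2; ring.
have /sin_gt0_pi s0 : 0 < t < pi.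
  rewrite /t !mulr_gt0 ?pi_gt0 ?invr_gt0 ?ltr0n//=.
  by rewrite -mulrA gtr_pMr ?pi_gt0// ltr_pdivrMr ?ltr0n// mul1r ltr_nat.
by rewrite lt_eqF// ltrBlDr ltrDl mulrn_wgt0// exprn_gt0.
Qed.

Lemma sum_complex n (f g : 'I_n -> R) :
  \sum_i (f i +i* g i) = (\sum_i f i) +i* (\sum_i g i).
Proof. by elim/big_rec3 : _ => // i x y _ _ ->. Qed.

Definition to_complex (z : 'rV[R]_2) : R[i] := z 0 0 +i* z 0 1.

Lemma norm_to_complexB (z v : 'rV[R]_2) : `|to_complex z - to_complex v| = (modulus (z - v))%:C.
Proof. by rewrite normc_def /modulus !mxE. Qed.

Lemma norm_to_complex (z : 'rV[R]_2) : `|to_complex z| = (modulus z)%:C.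
Proof. by rewrite normc_def. Qed.

(** Since 1 / u is the conjugate of u over |u|^2, each gradient summand is, up to conjugation and
    scaling, a simple fraction. *)
Lemma real_div_to_complexB (w : R) (z v : 'rV[R]_2) :
  w%:C / (to_complex z - to_complex v) = (w * ((z - v) 0 0 / modulus (z - v) ^+ 2)) -i*
                           (w * ((z - v) 0 1 / modulus (z - v) ^+ 2)).
Proof.
rewrite /modulus sqr_sqrtr ?addr_ge0 ?sqr_ge0// !mxE.
by apply/eqP; rewrite eq_complex /= !mul0r ?(subr0, addr0, mulrN, eqxx).
Qed.

Lemma to_complex_vertex n j : to_complex (vertex R n j) = expi (2 * pi / n%:R) ^+ j.
Proof.
rewrite expiX /to_complex /vertex /polar !mxE /= !mul1r /expi.
by rewrite -[2 * pi / _ *+ j]mulr_natr mulrAC.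
Qed.

Lemma modulus_vertex n j : modulus (vertex R n j) = 1.
Proof. by rewrite /modulus !mxE /= !mul1r cos2Dsin2 sqrtr1. Qed.

Lemma modulusB_le (z v : 'rV[R]_2) : modulus (z - v) <= modulus z + modulus v.
Proof.
by rewrite -lecR raddfD/= -norm_to_complexB -!norm_to_complex ler_normB.
Qed.

Lemma gradient_riesz_potential n (b : R) (z : 'rV[R]_2) k :
  (forall j, z != vertex R n j) ->
  gradient (riesz_potential n b) z 0 k =
  - 2 * b * \sum_(i < n) modulus (z - vertex R n i.+1) `^ (- 2 * b) *
      ((z - vertex R n i.+1) 0 k / modulus (z - vertex R n i.+1) ^+ 2).
Proof.
move=> zv; rewrite mxE.
have -> : riesz_potential n b = \sum_(i < n)
    (fun z : 'rV[R]_2 => modulus (z - vertex R n i.+1) `^ (- 2 * b)).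
  by apply/funext => y; rewrite fct_sumE /riesz_potential big_add1 /= big_mkord.
rewrite mulr_sumr.
have D (i : 'I_n) := is_derive_modulus_powR _ _ _ b k (zv (nat_of_ord i).+1).
by have [_ ->] := is_derive_sum D.
Qed.

Lemma equilibrium_sum n (b D : R) (z : 'rV[R]_2) : 0 < b -> 0 < D ->
  (forall j, z != vertex R n j) -> equilibrium n b z ->
  \sum_(i < n) ((D / modulus (z - vertex R n i.+1)) `^ (2 * b))%:C /
    (to_complex z - to_complex (vertex R n i.+1)) = 0.
Proof.
move=> b0 D0 zv [_ /rowP gz].
have g k : \sum_(i < n) (D / modulus (z - vertex R n i.+1)) `^ (2 * b) *
      ((z - vertex R n i.+1) 0 k / modulus (z - vertex R n i.+1) ^+ 2) = 0.
  have := gz k; rewrite [RHS]mxE gradient_riesz_potential// => /eqP.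
  rewrite mulf_eq0 mulf_eq0 oppr_eq0 pnatr_eq0 (gt_eqF b0)/= => /eqP gk.
  (* The factor -2b is nonzero and has been cancelled; multiplying the vanishing sum by D^(2b)
     normalizes the weights. *)
  rewrite -[RHS](mulr0 (D `^ (2 * b))) -[in RHS]gk mulr_sumr; apply: eq_bigr => i _.
  rewrite powRM ?(ltW D0) ?invr_ge0 ?modulus_ge0// -mulrA.
  by rewrite -powR_inv1 ?modulus_ge0// -powRrM mulNr mulN1r.
under eq_bigr do rewrite real_div_to_complexB.
by rewrite sum_complex sumrN !g oppr0.
Qed.

Lemma equilibrium_modulus_le n (b : R) (z : 'rV[R]_2) : (0 < n)%N -> 0 < b ->
  equilibrium n b z -> modulus z ^+ n.-1 <= b * 2 ^+ n.
Proof.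
case: n => // n _ b0 eqz; have [z1 _] := eqz.
(* The vertices have modulus 1, while z lies in the open disc. *)
have zv j : z != vertex R n.+1 j.
  by apply/eqP => zE; move: z1; rewrite zE modulus_vertex ltxx.
pose d (i : 'I_n.+1) := modulus (z - vertex R n.+1 i.+1).
have d0 i : 0 < d i by rewrite modulus_gt0// subr_eq0.
have d2 i : d i <= 2.
  by rewrite (le_trans (modulusB_le _ _))// modulus_vertex lerD2r ltW.
pose i0 := [arg min_(i < ord0) d i]%O.
have di0 i : d i0 <= d i by rewrite /i0; case: arg_minP => // j _; exact.
have normC0 (x : R) : 0 <= x -> `|x%:C| = x%:C by move=> ?; rewrite ger0_norm ?ler0c.
have : `|(\prod_(i < n.+1) ('X - (to_complex (vertex R n.+1 i.+1))%:P))^`().[to_complex z]| <=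
    ((2 * b)%:C *+ n.+1) * 2%:C ^+ n.
  apply: (@norm_horner_deriv_prod_XsubC_le _ n.+1 _
    (fun i => ((d i0 / d i) `^ (2 * b))%:C) _ _ _ i0).
  - by move=> i; rewrite -subr_eq0 -normr_gt0 norm_to_complexB ltcR d0.
  - exact: equilibrium_sum.
  - move=> i; have /andP[w0 w1] : 0 <= 1 - (d i0 / d i) `^ (2 * b) <= 2 * b * (d i / d i0).
      by rewrite one_sub_powR_le// ltW// mulr_gt0.
    by rewrite !norm_to_complexB -[1]/(1%:C) -rmorphB normC0// -fmorphV -!rmorphM lecR.
  - by move=> i; rewrite norm_to_complexB lecR d2.
  - by rewrite ler0c ltW// mulr_gt0.
(* The product is X^(n+1) - 1, with derivative (n+1) X^n; the factor n+1 cancels on both sides, and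
   2b 2^n = b 2^(n+1). *)
under eq_bigr do rewrite to_complex_vertex.
rewrite (prod_XsubC_unity _ _ _ (expi_prim_root _ _))// derivB derivC subr0 derivXn.
rewrite hornerMn hornerXn normrMn normrX norm_to_complex -!rmorphXn -!rmorphMn -rmorphM lecR.
by rewrite mulrnAl lerMn2r/= !natrX exprS mulrA [b * 2]mulrC.
Qed.

End Complex.

Theorem theorem4p2 (R : realType) (n : nat) (hn : (3 <= n)%N) (r : R -> R)
  (hr : forall b : R, 0 < b < 1 ->
     exists z : 'rV[R]_2,
       [/\ equilibrium n b z, z != 0 & r b = modulus z]) :
  r b @[b --> 0^'+] --> (0 : R).
Proof.
case: n hn hr => [//|[//|n]] _ hr.
(* The polygon now has [n.+2] vertices, so the power of the modulus that is bounded is the positive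
   exponent [n.+1]. *)
apply: (@cvg0_exp_le _ _ n (2 ^+ n.+2)) => b b01.
have [z [eqz _ ->]] := hr b b01; case/andP: b01 => b0 _.
by split; [exact: modulus_ge0|exact: (@equilibrium_modulus_le _ n.+2)].
Qed.
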